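(* Let $\mathbb{P}$ be a linear frame. If $V$ satisfies $\mathsf{ZFC}$, then the Kripke model $V^{\mathbb{P}}$ satisfies $\mathsf{DCom}$.
   Context: $\mathsf{DCom}$ (Axiom of Double Complement): $\forall x\,\exists y\,\forall z\,(\neg\neg(z\in x)\to z\in y)$. A frame is a partially ordered set $(\mathbb{P},\le)$ (in $V$) with a least element $\bot$; it is linear if $\le$ is a linear order. $\uparrow p=\{q\in\mathbb{P}\mid q\ge p\}$. Kripke sets: for an ordinal $\alpha$ and $p\in\mathbb{P}$, $V^{\mathbb{P}}_\alpha(p)$ is defined by recursion as the class of all functions $x$ with domain $\uparrow p$ such that (i) $x(q)\subseteq\bigcup_{\beta\in\alpha}V^{\mathbb{P}}_\beta(q)$ for all $q\ge p$, and (ii) (monotonicity) $\tau_{qr}''[x(q)]\subseteq x(r)$ for all $p\le q\le r$, where the transition function is $\tau_{qr}(y)=y\upharpoonright(\uparrow r)$ for $y$ with domain $\uparrow q$. Let $V^{\mathbb{P}}(p)=\bigcup_{\alpha\in\mathrm{Ord}}V^{\mathbb{P}}_\alpha(p)$ and $V^{\mathbb{P}}=\bigcup_{p}V^{\mathbb{P}}(p)$. Forcing: for parameters in $V^{\mathbb{P}}(p)$, $p\Vdash x\in y$ iff $x\in y(p)$; $p\Vdash x=y$ iff $x(q)=y(q)$ for all $q\ge p$; $p\Vdash\phi\land\psi$ iff $p\Vdash\phi$ and $p\Vdash\psi$; $p\Vdash\phi\lor\psi$ iff $p\Vdash\phi$ or $p\Vdash\psi$; $p\Vdash\phi\to\psi$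 iff for each $q\ge p$, $q\Vdash\phi$ implies $q\Vdash\psi$; $p\Vdash\forall x\,\phi(x)$ iff $q\Vdash\phi(x)$ for each $q\ge p$ and $x\in V^{\mathbb{P}}(q)$; $p\Vdash\exists x\,\phi(x)$ iff $p\Vdash\phi(x)$ for some $x\in V^{\mathbb{P}}(p)$; no $p$ forces falsum, and $\neg\phi$ is $\phi\to$ falsum. A parameter $a\in V^{\mathbb{P}}(r)$ with $r\le q$ is read at node $q$ as $\tau_{rq}(a)$. $V^{\mathbb{P}}$ satisfies a sentence if $\bot$ forces it. *)

(* Defs.v *)
(* The ground universe V is an arbitrary first-order structure with one binary
   relation, equality being interpreted as Leibniz equality.  It need not be
   well-founded or transitive from the outside, so every set-theoretic notion
   below is expressed inside V, by quantification over its elements. *)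

Record eps_structure : Type := EpsStructure {
  carrier :> Type;
  mem : carrier -> carrier -> Prop
}.
Arguments mem {e} _ _.

Declare Scope eps_scope.
Notation "x ∈ y" := (mem x y) (at level 70, no associativity) : eps_scope.
Local Open Scope eps_scope.

(* First-order formulas of the language {∈, =} with free variables in A; a
   quantifier binds the variable [None] of [option A].  Negation and falsum are
   as in intuitionistic logic. *)
Inductive form (A : Type) : Type :=
| fFalse : form A
| fMem : A -> A -> form A
| fEq : A -> A -> form A
| fAnd : form A -> form A -> form A
| fOr : form A -> form A -> form A
| fImp : form A -> form A -> form A
| fAll : form (option A) -> form A
| fEx : form (option A) -> form A.
Arguments fFalse {A}.
Arguments fMem {A} _ _.
Arguments fEq {A} _ _.
Arguments fAnd {A} _ _.
Arguments fOr {A} _ _.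
Arguments fImp {A} _ _.
Arguments fAll {A} _.
Arguments fEx {A} _.

Definition fNot {A : Type} (phi : form A) : form A := fImp phi fFalse.

Definition sentence : Type := form Empty_set.

Definition env_nil {T : Type} (a : Empty_set) : T := match a with end.

Definition env_cons {A T : Type} (x : T) (e : A -> T) (a : option A) : T :=
  match a with None => x | Some b => e b end.

(* ∀x ∃y ∀z (¬¬(z ∈ x) → z ∈ y) *)
Definition DCom : sentence :=
  let x := Some (Some None) in
  let y := Some None in
  let z := None in
  fAll (fEx (fAll (fImp (fNot (fNot (fMem z x))) (fMem z y)))).

(* Tarskian satisfaction in V. *)
Fixpoint sat {V : eps_structure} {A : Type} (phi : form A) (e : A -> V) : Prop :=
  match phi with
  | fFalse => False
  | fMem a b => e a ∈ e b
  | fEq a b => e a = e b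
  | fAnd f g => sat f e /\ sat g e
  | fOr f g => sat f e \/ sat g e
  | fImp f g => sat f e -> sat g e
  | fAll f => forall x : V, sat f (env_cons x e)
  | fEx f => exists x : V, sat f (env_cons x e)
  end.

(* z = {a, b} *)
Definition is_upair {V : eps_structure} (z a b : V) : Prop :=
  forall w : V, w ∈ z <-> w = a \/ w = b.

(* s = a ∪ {a} *)
Definition is_succ {V : eps_structure} (s a : V) : Prop :=
  forall w : V, w ∈ s <-> w ∈ a \/ w = a.

(* The single axioms are spelled out as the unfolding of their satisfaction in
   V; in the two schemas the variables in [nat] are the parameters. *)
Record ZFC (V : eps_structure) : Prop := {
  zfc_extensionality :
    forall x y : V, (forall z : V, z ∈ x <-> z ∈ y) -> x = y;
  zfc_foundation :
    forall a : V, (exists x : V, x ∈ a) ->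
      exists x : V, x ∈ a /\ ~ (exists y : V, y ∈ x /\ y ∈ a);
  zfc_pairing :
    forall a b : V, exists z : V, is_upair z a b;
  zfc_union :
    forall a : V, exists u : V,
      forall x : V, x ∈ u <-> exists y : V, y ∈ a /\ x ∈ y;
  zfc_powerset :
    forall a : V, exists b : V,
      forall x : V, x ∈ b <-> (forall z : V, z ∈ x -> z ∈ a);
  zfc_infinity :
    exists w : V,
      (exists o : V, o ∈ w /\ forall z : V, ~ z ∈ o) /\
      (forall x : V, x ∈ w -> exists s : V, s ∈ w /\ is_succ s x);
  zfc_separation :
    forall (phi : form (option nat)) (e : nat -> V) (a : V),
      exists b : V,
        forall x : V, x ∈ b <-> x ∈ a /\ sat phi (env_cons x e);
  zfc_replacement :
    forall (phi : form (option (option nat))) (e : nat -> V) (a : V),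
      (forall x y y' : V, x ∈ a ->
        sat phi (env_cons y (env_cons x e)) ->
        sat phi (env_cons y' (env_cons x e)) -> y = y') ->
      exists b : V,
        forall y : V, y ∈ b <->
          exists x : V, x ∈ a /\ sat phi (env_cons y (env_cons x e));
  zfc_choice :
    forall a : V,
      (forall x : V, x ∈ a -> exists z : V, z ∈ x) ->
      (forall x y z : V, x ∈ a -> y ∈ a -> z ∈ x -> z ∈ y -> x = y) ->
      exists c : V, forall x : V, x ∈ a -> exists! z : V, z ∈ c /\ z ∈ x
}.

(* o is the Kuratowski pair {{a}, {a, b}}. *)
Definition is_opair {V : eps_structure} (o a b : V) : Prop :=
  forall z : V, z ∈ o <-> is_upair z a a \/ is_upair z a b.

(* (a, b) ∈ f; for a function f this says f(a) = b. *)
Definition maps {V : eps_structure} (f a b : V) : Prop :=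
  exists o : V, is_opair o a b /\ o ∈ f.

Definition is_fun_on {V : eps_structure} (D : V -> Prop) (f : V) : Prop :=
  (forall o : V, o ∈ f -> exists a b : V, is_opair o a b /\ D a) /\
  (forall a : V, D a -> exists! b : V, maps f a b).

(* g is the restriction of f to D. *)
Definition is_restr {V : eps_structure} (D : V -> Prop) (f g : V) : Prop :=
  forall o : V, o ∈ g <-> o ∈ f /\ exists a b : V, is_opair o a b /\ D a.

Definition transitive_set {V : eps_structure} (a : V) : Prop :=
  forall x y : V, x ∈ a -> y ∈ x -> y ∈ a.

Definition Ord {V : eps_structure} (a : V) : Prop :=
  transitive_set a /\ forall x : V, x ∈ a -> transitive_set x.

(* A frame that is a set of V: its domain, its order (a set of ordered pairs)
   and its least element are elements of V. *)
Record frame (V : eps_structure) : Type := Frame {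
  dom : V;
  ord : V;
  bot : V;
  frame_rel : forall o : V, o ∈ ord ->
    exists p q : V, is_opair o p q /\ p ∈ dom /\ q ∈ dom;
  frame_refl : forall p : V, p ∈ dom -> maps ord p p;
  frame_antisym : forall p q : V, maps ord p q -> maps ord q p -> p = q;
  frame_trans : forall p q r : V, maps ord p q -> maps ord q r -> maps ord p r;
  frame_bot_dom : bot ∈ dom;
  frame_bot_least : forall p : V, p ∈ dom -> maps ord bot p
}.
Arguments dom {V} _.
Arguments ord {V} _.
Arguments bot {V} _.

Definition frame_le {V : eps_structure} (P : frame V) (p q : V) : Prop :=
  maps (ord P) p q.

Definition linear {V : eps_structure} (P : frame V) : Prop :=
  forall p q : V, p ∈ dom P -> q ∈ dom P -> frame_le P p q \/ frame_le P q p.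

(* q ∈ ↑p *)
Definition up {V : eps_structure} (P : frame V) (p q : V) : Prop :=
  q ∈ dom P /\ frame_le P p q.

(* y' = τ_{qr}(y) for y with domain ↑q and q ≤ r; q is not needed. *)
Definition transition {V : eps_structure} (P : frame V) (r y y' : V) : Prop :=
  is_restr (up P r) y y'.

(* The class of the functions x with domain ↑p satisfying (i) and (ii), where
   [U q] stands for the union of the V_β(q) over all β ∈ α. *)
Definition kripke_step {V : eps_structure} (P : frame V)
    (U : V -> V -> Prop) (p x : V) : Prop :=
  is_fun_on (up P p) x /\
  (forall q xq y : V, up P p q -> maps x q xq -> y ∈ xq -> U q y) /\
  (forall q r xq xr y y' : V, up P p q -> up P q r ->
     maps x q xq -> maps x r xr -> y ∈ xq -> transition P r y y' -> y' ∈ xr).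

(* y ∈ G(β, q) *)
Definition in_stage {V : eps_structure} (G b q y : V) : Prop :=
  exists o W : V, is_opair o b q /\ maps G o W /\ y ∈ W.

(* Recursion on ordinals inside V: G is the function (β, p) ↦ V_β(p) for β ≤ α
   and p in the frame.  V being a model of ZFC, each V_β(p) is a set and G
   exists and is unique for every ordinal α. *)
Definition is_hierarchy {V : eps_structure} (P : frame V) (alpha G : V) : Prop :=
  is_fun_on (fun o => exists b p : V,
               is_opair o b p /\ (b ∈ alpha \/ b = alpha) /\ p ∈ dom P) G /\
  (forall b p x : V, b ∈ alpha \/ b = alpha -> p ∈ dom P ->
     (in_stage G b p x <->
      kripke_step P (fun q y => exists c : V, c ∈ b /\ in_stage G c q y) p x)).

(* x ∈ V_α(p) *)
Definition VP_at {V : eps_structure} (P : frame V) (alpha p x : V) : Prop :=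
  exists G : V, is_hierarchy P alpha G /\ in_stage G alpha p x.

(* x ∈ V(p) *)
Definition VP {V : eps_structure} (P : frame V) (p x : V) : Prop :=
  exists alpha : V, Ord alpha /\ VP_at P alpha p x.

(* p ⊩ φ[e].  A parameter [e a] may live at a node r ≤ p and is kept there; it
   is read at p as τ_{rp}(e a), which changes neither its values at nodes above
   p nor its later restrictions, so that only the left-hand side of ∈ needs an
   explicit transition. *)
Fixpoint forces {V : eps_structure} (P : frame V) {A : Type} (phi : form A)
    (p : V) (e : A -> V) : Prop :=
  match phi with
  | fFalse => False
  | fMem a b =>
      exists x yp : V, transition P p (e a) x /\ maps (e b) p yp /\ x ∈ yp
  | fEq a b =>
      forall q : V, up P p q ->
        exists v : V, maps (e a) q v /\ maps (e b) q v
  | fAnd f g => forces P f p e /\ forces P g p e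
  | fOr f g => forces P f p e \/ forces P g p e
  | fImp f g =>
      forall q : V, up P p q -> forces P f q e -> forces P g q e
  | fAll f =>
      forall q x : V, up P p q -> VP P q x -> forces P f q (env_cons x e)
  | fEx f =>
      exists x : V, VP P p x /\ forces P f p (env_cons x e)
  end.

Definition kripke_satisfies {V : eps_structure} (P : frame V)
    (phi : sentence) : Prop :=
  forces P phi (bot P) env_nil.

(* Main.v *)
Require Import Defs.
From Stdlib Require Import Classical List.
Import ListNotations.
Local Open Scope eps_scope.

(** Let [x] be a Kripke set of stage [alpha] at the node [p].  In a linear frame
    a node [q] forces [¬¬(z ∈ x)] exactly when [z], restricted to some later
    node [r], belongs to [x(r)]: of two nodes above [q] the larger one is a
    common bound, and membership in [x] persists.  So the wanted [y] takes at
    [q] the value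

      [y(q) = { z ∈ V(q) | τ_{qr}(z) ∈ x(r) for some r ≥ q }].

    Monotonicity of [y] is again a comparison of two nodes; what is not obvious
    is that [y(q)] is a set, since many [z] at [q] can restrict to the same
    element of [x(r)].  Linearity bounds their rank ([stage_reflection]): if [z]
    is a Kripke set at [q] and [τ_{qr}(z)] lies in [V_b(r)], then [z] already
    lies in [V_b(q)].  Indeed a node [s ≥ q] is either above [r], where [z] and
    its restriction have the same value, or below [r], where an element of
    [z(s)] restricts to an element of [z(r)], hence lies in some [V_d(r)] with
    [d ∈ b], and induction on [b] puts it in [V_d(s)].  Hence [y(q)] is
    contained in the union of the [V_b(q)] with [b ∈ alpha], and [y] is itself
    of stage [alpha] at [p].

    The stages of [x] and of [z] come with possibly different hierarchies, which
    [stage_reflection] compares directly; [y] is placed in the hierarchy that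
    witnesses [x].

    The universe may be ill-founded from the outside, so the induction and the
    set formations happen inside it and need first-order definitions.  These
    are produced by closure rules for definable relations. *)

(** * Definability with parameters *)

Section Definability.
Context {V : eps_structure} (params : list V) (dflt : V).

(** The parameters are listed once and for all, the default filling the indices
    beyond the list; this way two definitions use the same parameters, and
    connectives can be formed without renaming variables. *)
Definition param (n : nat) : V := nth n params dflt.

Definition assigns {A : Type} (i : nat -> A) (e : A -> V) : Prop :=
  forall n : nat, e (i n) = param n.

(** The map [i] says which variables of the context hold the parameters;
    it changes under a quantifier, while the list of parameters does not.  The
    relation is stated semantically, so that a rule applies to any Rocq
    proposition of the right shape, with its defined notions unfolded. *)
Definition definable {A : Type} (i : nat -> A) (R : (A -> V) -> Prop) : Prop :=
  exists phi : form A, forall e : A -> V, assigns i e -> (sat phi e <-> R e).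

Definition definable_term {A : Type} (i : nat -> A) (t : (A -> V) -> V) : Prop :=
  exists a : A, forall e : A -> V, assigns i e -> e a = t e.

Lemma term_var {A : Type} (i : nat -> A) (a : A) :
  definable_term i (fun e => e a).
Proof. now exists a. Qed.

Lemma term_param {A : Type} (i : nat -> A) (n : nat) :
  definable_term i (fun _ => param n).
Proof. exists (i n). intros e He. apply He. Qed.

Lemma definable_mem {A : Type} (i : nat -> A) (s t : (A -> V) -> V) :
  definable_term i s -> definable_term i t -> definable i (fun e => s e ∈ t e).
Proof.
  intros [a Ha] [b Hb]. exists (fMem a b). intros e He. cbn.
  now rewrite (Ha e He), (Hb e He).
Qed.

Lemma definable_eq {A : Type} (i : nat -> A) (s t : (A -> V) -> V) :
  definable_term i s -> definable_term i t -> definable i (fun e => s e = t e).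
Proof.
  intros [a Ha] [b Hb]. exists (fEq a b). intros e He. cbn.
  now rewrite (Ha e He), (Hb e He).
Qed.

Lemma definable_and {A : Type} (i : nat -> A) (R S : (A -> V) -> Prop) :
  definable i R -> definable i S -> definable i (fun e => R e /\ S e).
Proof.
  intros [f Hf] [g Hg]. exists (fAnd f g). intros e He. cbn.
  now rewrite (Hf e He), (Hg e He).
Qed.

Lemma definable_or {A : Type} (i : nat -> A) (R S : (A -> V) -> Prop) :
  definable i R -> definable i S -> definable i (fun e => R e \/ S e).
Proof.
  intros [f Hf] [g Hg]. exists (fOr f g). intros e He. cbn.
  now rewrite (Hf e He), (Hg e He).
Qed.

Lemma definable_imp {A : Type} (i : nat -> A) (R S : (A -> V) -> Prop) :
  definable i R -> definable i S -> definable i (fun e => R e -> S e).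
Proof.
  intros [f Hf] [g Hg]. exists (fImp f g). intros e He. cbn.
  now rewrite (Hf e He), (Hg e He).
Qed.

Lemma definable_not {A : Type} (i : nat -> A) (R : (A -> V) -> Prop) :
  definable i R -> definable i (fun e => ~ R e).
Proof.
  intros [f Hf]. exists (fNot f). intros e He. cbn.
  now rewrite (Hf e He).
Qed.

Lemma definable_iff {A : Type} (i : nat -> A) (R S : (A -> V) -> Prop) :
  definable i R -> definable i S -> definable i (fun e => R e <-> S e).
Proof. intros HR HS. now apply definable_and; apply definable_imp. Qed.

Lemma definable_all {A : Type} (i : nat -> A) (R : (A -> V) -> V -> Prop) :
  definable (fun n => Some (i n)) (fun e => R (fun a => e (Some a)) (e None)) ->
  definable i (fun e => forall x : V, R e x).
Proof.
  intros [f Hf]. exists (fAll f). intros e He. cbn.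
  split; intros H x; apply (Hf (env_cons x e)); auto; exact (H x).
Qed.

Lemma definable_ex {A : Type} (i : nat -> A) (R : (A -> V) -> V -> Prop) :
  definable (fun n => Some (i n)) (fun e => R (fun a => e (Some a)) (e None)) ->
  definable i (fun e => exists x : V, R e x).
Proof.
  intros [f Hf]. exists (fEx f). intros e He. cbn.
  split; intros [x H]; exists x; apply (Hf (env_cons x e)); auto; exact H.
Qed.

End Definability.

(** A term is a variable or one of the listed parameters, the latter recognized
    up to conversion. *)
Ltac solve_term :=
  first [ refine (term_var _ _ _ _)
        | refine (term_param _ _ _ 0) | refine (term_param _ _ _ 1)
        | refine (term_param _ _ _ 2) | refine (term_param _ _ _ 3)
        | refine (term_param _ _ _ 4) | refine (term_param _ _ _ 5) ].

Ltac solve_definable :=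
  cbv beta delta [in_stage up frame_le transition is_restr maps is_opair is_upair];
  repeat
    (cbv beta;
     lazymatch goal with
     | |- definable _ _ _ (fun e => _ /\ _) => refine (definable_and _ _ _ _ _ _ _)
     | |- definable _ _ _ (fun e => _ \/ _) => refine (definable_or _ _ _ _ _ _ _)
     | |- definable _ _ _ (fun e => _ <-> _) => refine (definable_iff _ _ _ _ _ _ _)
     | |- definable _ _ _ (fun e => exists x, _) => refine (definable_ex _ _ _ _ _)
     | |- definable _ _ _ (fun e => ~ _) => refine (definable_not _ _ _ _ _)
     | |- definable _ _ _ (fun e => _ = _) => refine (definable_eq _ _ _ _ _ _ _)
     | |- definable _ _ _ (fun e => _ ∈ _) => refine (definable_mem _ _ _ _ _ _ _)
     | |- definable _ _ _ (fun e => forall x : carrier _, _) =>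
         refine (definable_all _ _ _ _ _)
     | |- definable _ _ _ _ => refine (definable_imp _ _ _ _ _ _ _)
     | |- definable_term _ _ _ _ => solve_term
     end).

(** * Set theory inside the universe *)

Section Universe.
Context {V : eps_structure} (HV : ZFC V).

Lemma separation (ps : list V) (d : V) (R : V -> Prop) (a : V) :
  definable ps d (@Some nat) (fun e => R (e None)) ->
  exists b : V, forall x : V, x ∈ b <-> x ∈ a /\ R x.
Proof.
  intros [phi Hphi].
  destruct (zfc_separation V HV phi (param ps d) a) as [b Hb].
  exists b. intros x. rewrite Hb.
  now rewrite (Hphi (env_cons x (param ps d)) (fun n => eq_refl)).
Qed.

Lemma replacement (ps : list V) (d : V) (R : V -> V -> Prop) (a : V) :
  definable ps d (fun n : nat => Some (Some n))
    (fun e => R (e (Some None)) (e None)) ->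
  (forall x y y' : V, R x y -> R x y' -> y = y') ->
  exists b : V, forall y : V, y ∈ b <-> exists x : V, x ∈ a /\ R x y.
Proof.
  intros [phi Hphi] Hfun.
  assert (Hsat : forall x y : V,
    sat phi (env_cons y (env_cons x (param ps d))) <-> R x y).
  { intros x y. exact (Hphi (env_cons y (env_cons x (param ps d)))
                            (fun n => eq_refl)). }
  destruct (zfc_replacement V HV phi (param ps d) a) as [b Hb].
  - intros x y y' _. rewrite !Hsat. apply Hfun.
  - exists b. intros y. rewrite Hb.
    now split; intros [x Hx]; exists x; rewrite Hsat in *.
Qed.

(** Foundation gives induction along any transitive set; the top element
    [alpha] is included because its members are exactly the previous cases. *)
Lemma ordinal_induction (ps : list V) (d : V) (R : V -> Prop) (alpha : V) :
  definable ps d (@Some nat) (fun e => R (e None)) ->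
  transitive_set alpha ->
  (forall b : V, b ∈ alpha \/ b = alpha -> (forall c : V, c ∈ b -> R c) -> R b) ->
  forall b : V, b ∈ alpha \/ b = alpha -> R b.
Proof.
  intros HR Htr Hstep.
  destruct (separation ps d (fun x => ~ R x) alpha) as [S HS].
  { refine (definable_not _ _ _ _ _). exact HR. }
  assert (Hin : forall b : V, b ∈ alpha -> R b).
  { intros b Hb. apply NNPP. intros Hn.
    destruct (zfc_foundation V HV S) as [m [Hm Hmin]].
    - exists b. now apply HS.
    - apply HS in Hm as [Hma HmR]. apply HmR, Hstep; [now left|].
      intros c Hc. apply NNPP. intros HcR. apply Hmin. exists c.
      split; [assumption|]. apply HS. split; [|assumption].
      exact (Htr m c Hma Hc). }
  intros b [Hb| ->]; [now apply Hin|].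
  apply Hstep; [now right|assumption].
Qed.

Lemma upair_unique (a b z z' : V) : is_upair z a b -> is_upair z' a b -> z = z'.
Proof.
  intros H H'. apply (zfc_extensionality V HV). intros w. now rewrite (H w), (H' w).
Qed.

Lemma opair_exists (a b : V) : exists o : V, is_opair o a b.
Proof.
  destruct (zfc_pairing V HV a a) as [s Hs].
  destruct (zfc_pairing V HV a b) as [t Ht].
  destruct (zfc_pairing V HV s t) as [o Ho].
  exists o. intros z. rewrite (Ho z). split.
  - intros [-> | ->]; auto.
  - intros [Hz|Hz]; [left|right]; eapply upair_unique; eassumption.
Qed.

Lemma opair_unique (o o' a b : V) : is_opair o a b -> is_opair o' a b -> o = o'.
Proof.
  intros H H'. apply (zfc_extensionality V HV). intros w. now rewrite (H w), (H' w).
Qed.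

Lemma opair_inj (o a b c d : V) :
  is_opair o a b -> is_opair o c d -> a = c /\ b = d.
Proof.
  intros H H'.
  assert (Hiff : forall z : V, is_upair z a a \/ is_upair z a b <->
                               is_upair z c c \/ is_upair z c d).
  { intros z. now rewrite <- (H z), <- (H' z). }
  assert (Hac : a = c).
  { destruct (zfc_pairing V HV a a) as [s Hs].
    assert (Hcs : c ∈ s).
    { destruct (proj1 (Hiff s) (or_introl Hs)) as [E|E]; apply E; auto. }
    apply Hs in Hcs. now destruct Hcs. }
  subst c. split; [reflexivity|].
  destruct (zfc_pairing V HV a b) as [t Ht].
  destruct (zfc_pairing V HV a d) as [t' Ht'].
  assert (Hb : b = a \/ b = d).
  { assert (Hbt : b ∈ t) by (apply Ht; auto).
    destruct (proj1 (Hiff t) (or_intror Ht)) as [E|E]; apply E in Hbt; tauto. }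
  assert (Hd : d = a \/ d = b).
  { assert (Hdt : d ∈ t') by (apply Ht'; auto).
    destruct (proj2 (Hiff t') (or_intror Ht')) as [E|E]; apply E in Hdt; tauto. }
  destruct Hb as [Hb|Hb], Hd as [Hd|Hd]; congruence.
Qed.

Lemma maps_restr (D : V -> Prop) (f g a b : V) :
  is_restr D f g -> (maps g a b <-> maps f a b /\ D a).
Proof.
  intros H. split.
  - intros [o [Ho Hg]]. apply H in Hg as [Hf (a' & b' & Ho' & HD)].
    destruct (opair_inj _ _ _ _ _ Ho Ho') as [-> _].
    split; [now exists o|assumption].
  - intros [[o [Ho Hf]] HD]. exists o. split; [assumption|].
    apply H. split; [assumption|]. now exists a, b.
Qed.

Lemma restr_fun (D D' : V -> Prop) (f g : V) :
  (forall a : V, D' a -> D a) ->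
  is_fun_on D f -> is_restr D' f g -> is_fun_on D' g.
Proof.
  intros Hsub Hf Hg. split.
  - intros o Ho. now apply Hg in Ho.
  - intros a Ha. destruct (proj2 Hf a (Hsub a Ha)) as [b [Hb Hu]].
    exists b. split.
    + now apply (maps_restr _ _ _ _ _ Hg).
    + intros b' Hb'. apply Hu. now apply (maps_restr _ _ _ _ _ Hg) in Hb'.
Qed.

Lemma restr_restr (D D' : V -> Prop) (f g h : V) :
  (forall a : V, D' a -> D a) ->
  is_restr D f g -> (is_restr D' g h <-> is_restr D' f h).
Proof.
  intros Hsub Hg.
  enough (E : forall o : V,
    (o ∈ g /\ exists a b : V, is_opair o a b /\ D' a) <->
    (o ∈ f /\ exists a b : V, is_opair o a b /\ D' a)).
  { split; intros H o; now rewrite (H o), (E o). }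
  intros o. rewrite (Hg o). split.
  - now intros [[Hf _] H].
  - intros [Hf (a & b & Ho & Ha)].
    split; [split; [assumption|]|]; exists a, b; auto.
Qed.

(** Replacement applied to [q ↦ (q, Y)], where [Y] is the set with members
    given by [R q]. *)
Lemma function_by_values (ps : list V) (d : V) (D : V -> Prop)
    (R : V -> V -> Prop) (a : V) :
  definable ps d (fun n : nat => Some (Some n))
    (fun e => D (e (Some None)) /\ exists Y : V,
       is_opair (e None) (e (Some None)) Y /\
       forall z : V, z ∈ Y <-> R (e (Some None)) z) ->
  (forall q : V, D q -> q ∈ a) ->
  (forall q : V, D q -> exists Y : V, forall z : V, z ∈ Y <-> R q z) ->
  exists f : V, is_fun_on D f /\
    forall q Y z : V, maps f q Y -> (z ∈ Y <-> R q z).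
Proof.
  intros Hdef Ha HY.
  assert (Hext : forall q Y Y' : V, (forall z, z ∈ Y <-> R q z) ->
            (forall z, z ∈ Y' <-> R q z) -> Y = Y').
  { intros q Y Y' E E'. apply (zfc_extensionality V HV). intros z.
    now rewrite (E z), (E' z). }
  destruct (replacement ps d
    (fun q o => D q /\ exists Y : V,
       is_opair o q Y /\ forall z : V, z ∈ Y <-> R q z) a Hdef) as [f Hf].
  { intros q o o' (_ & Y & Ho & E) (_ & Y' & Ho' & E').
    rewrite (Hext q Y Y' E E') in Ho. eapply opair_unique; eassumption. }
  assert (Hmaps : forall q Y, maps f q Y -> forall z, z ∈ Y <-> R q z).
  { intros q Y [o [Ho Hin]]. apply Hf in Hin as (q' & _ & _ & Y' & Ho' & E).
    now destruct (opair_inj _ _ _ _ _ Ho Ho') as [-> ->]. }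
  exists f. split; [split|].
  - intros o Ho. apply Hf in Ho as (q & _ & HD & Y & Ho & _). now exists q, Y.
  - intros q HD. destruct (HY q HD) as [Y E].
    destruct (opair_exists q Y) as [o Ho]. exists Y. split.
    + exists o. split; [assumption|]. apply Hf. exists q.
      split; [now apply Ha|]. split; [assumption|]. now exists Y.
    + intros Y' HY'. exact (Hext q Y Y' E (Hmaps q Y' HY')).
  - intros q Y z H. now apply Hmaps.
Qed.

(** Kuratowski pairs bury the value [W] two levels deep in [G], so the third
    union of [G] contains the members of all its values.  This is the bound that
    separation needs for collecting elements of stages. *)
Lemma maps_members_bounded (G : V) :
  exists B : V, forall o W y : V, maps G o W -> y ∈ W -> y ∈ B.
Proof.
  destruct (zfc_union V HV G) as [B1 H1].
  destruct (zfc_union V HV B1) as [B2 H2].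
  destruct (zfc_union V HV B2) as [B3 H3].
  exists B3. intros o W y [k [Hk HG]] Hy.
  destruct (zfc_pairing V HV o W) as [t Ht].
  apply H3. exists W. split; [|assumption].
  apply H2. exists t. split; [|apply Ht; auto].
  apply H1. exists k. split; [assumption|]. apply Hk. now right.
Qed.

End Universe.

(** * Kripke sets over a frame *)

Section Frame.
Context {V : eps_structure} (HV : ZFC V) (P : frame V).

Lemma up_dom (p q : V) : up P p q -> p ∈ dom P.
Proof.
  intros [_ [o [Ho Hin]]].
  destruct (frame_rel V P o Hin) as (p' & q' & Ho' & Hp & _).
  now destruct (opair_inj HV _ _ _ _ _ Ho Ho') as [-> _].
Qed.

Lemma up_refl (p : V) : p ∈ dom P -> up P p p.
Proof. intros Hp. split; [assumption|]. now apply frame_refl. Qed.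

Lemma up_trans (p q r : V) : up P p q -> up P q r -> up P p r.
Proof.
  intros [_ H] [Hr H']. split; [assumption|]. eapply frame_trans; eassumption.
Qed.

Lemma transition_exists (r y : V) : exists y' : V, transition P r y y'.
Proof.
  apply (separation HV [dom P; ord P; r] y
    (fun o => exists a b : V, is_opair o a b /\ up P r a)).
  solve_definable.
Qed.

Lemma transition_through (q r z zq zr : V) :
  up P q r -> transition P q z zq ->
  (transition P r zq zr <-> transition P r z zr).
Proof.
  intros Hqr Hz. apply (restr_restr (up P q)); [|assumption].
  intros s Hs. now apply up_trans with r.
Qed.

(** Both clauses in the definition of a Kripke set quantify over later nodes
    only, so they pass to restrictions. *)
Lemma kripke_step_transition (U : V -> V -> Prop) (q r z z' : V) :
  kripke_step P U q z -> up P q r -> transition P r z z' ->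
  kripke_step P U r z'.
Proof.
  intros (Hfun & Hval & Hmono) Hqr Hz'.
  assert (Hsub : forall s : V, up P r s -> up P q s).
  { intros s Hs. now apply up_trans with r. }
  split; [|split].
  - exact (restr_fun HV _ _ _ _ Hsub Hfun Hz').
  - intros s zs y Hs Hm Hy. apply (maps_restr HV _ _ _ _ _ Hz') in Hm as [Hm _].
    exact (Hval s zs y (Hsub s Hs) Hm Hy).
  - intros s t zs zt y y' Hs Ht Hms Hmt.
    apply (maps_restr HV _ _ _ _ _ Hz') in Hms as [Hms _].
    apply (maps_restr HV _ _ _ _ _ Hz') in Hmt as [Hmt _].
    exact (Hmono s t zs zt y y' (Hsub s Hs) Ht Hms Hmt).
Qed.

Lemma stage_transition (alpha G b q r z z' : V) :
  is_hierarchy P alpha G -> b ∈ alpha \/ b = alpha ->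
  in_stage G b q z -> up P q r -> transition P r z z' -> in_stage G b r z'.
Proof.
  intros [_ HG] Hb Hz Hqr Hz'.
  apply HG; [assumption|exact (proj1 Hqr)|].
  apply (kripke_step_transition _ q r z); try assumption.
  apply HG; [assumption|exact (up_dom _ _ Hqr)|assumption].
Qed.

(** Restricting to a later node of a linear frame does not lower the stage.
    The induction on [b] needs [w] to be a Kripke set at [q] beforehand, of
    whatever stage and in whatever hierarchy, so that its values below [r]
    consist of Kripke sets to which the induction hypothesis applies. *)
Lemma stage_reflection (alpha G alpha' G' : V) :
  linear P ->
  transitive_set alpha -> is_hierarchy P alpha G ->
  transitive_set alpha' -> is_hierarchy P alpha' G' ->
  forall b : V, b ∈ alpha \/ b = alpha ->
  forall c q r w u : V, c ∈ alpha' \/ c = alpha' -> up P q r ->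
    in_stage G' c q w -> transition P r w u -> in_stage G b r u ->
    in_stage G b q w.
Proof.
  intros HP Htr [_ HG] Htr' [_ HG'].
  apply (ordinal_induction HV [dom P; ord P; G; alpha'; G'] alpha
    (fun b => forall c q r w u : V, c ∈ alpha' \/ c = alpha' -> up P q r ->
       in_stage G' c q w -> transition P r w u -> in_stage G b r u ->
       in_stage G b q w));
    [solve_definable|assumption|].
  intros b Hb IH c q r w u Hc Hqr Hw Hu Hub.
  assert (Hlow : forall x y z : V, transitive_set z -> x ∈ y ->
            y ∈ z \/ y = z -> x ∈ z).
  { intros x y z Hz Hxy [Hy| ->]; [exact (Hz y x Hy Hxy)|assumption]. }
  pose proof (up_dom _ _ Hqr) as Hq.
  apply HG' in Hw as (Hfun & Hval & Hmono); try assumption.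
  apply HG in Hub as (_ & Hvalu & _); [|assumption|exact (proj1 Hqr)].
  apply HG; try assumption.
  split; [assumption|]. split; [|assumption].
  intros s ws v Hs Hms Hv.
  destruct (HP r s (proj1 Hqr) (proj1 Hs)) as [Hrs|Hsr].
  - assert (Hup : up P r s) by (split; [exact (proj1 Hs)|assumption]).
    apply (Hvalu s ws v Hup); [|assumption].
    now apply (maps_restr HV _ _ _ _ _ Hu).
  - assert (Hup : up P s r) by (split; [exact (proj1 Hqr)|assumption]).
    destruct (proj2 Hfun r Hqr) as [wr [Hmr _]].
    destruct (transition_exists r v) as [v' Hv'].
    pose proof (Hmono s r ws wr v v' Hs Hup Hms Hmr Hv Hv') as Hin.
    assert (Hmu : maps u r wr).
    { apply (maps_restr HV _ _ _ _ _ Hu). split; [assumption|].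
      exact (up_refl r (proj1 Hqr)). }
    (* [u] is the restriction of [w], so [v'] is a member of [u(r)] and its
       stage is below [b]. *)
    destruct (Hvalu r wr v' (up_refl r (proj1 Hqr)) Hmu Hin) as [d [Hd Hvd]].
    destruct (Hval s ws v Hs Hms Hv) as [c' [Hc' Hvc']].
    exists d. split; [assumption|].
    apply (IH d Hd c' s r v v'); try assumption.
    left. exact (Hlow c' c alpha' Htr' Hc' Hc).
Qed.

(** In a linear frame this is the meaning of [q ⊩ ¬¬(z ∈ x)]. *)
Definition eventually_in (x q z : V) : Prop :=
  exists r zr xr : V, up P q r /\ transition P r z zr /\ maps x r xr /\ zr ∈ xr.

(** [y] is cut out of the stages below [alpha], which makes its values sets and
    puts [y] into stage [alpha]; linearity gives monotonicity: when [z] enters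
    [x] at [r] and is restricted to [s], it has entered [x] by the larger of
    [r] and [s]. *)
Lemma double_complement_exists (alpha G p x : V) :
  linear P -> transitive_set alpha -> is_hierarchy P alpha G ->
  in_stage G alpha p x -> p ∈ dom P ->
  exists y : V, in_stage G alpha p y /\
    forall q Y z : V, maps y q Y ->
      (z ∈ Y <-> (exists b : V, b ∈ alpha /\ in_stage G b q z) /\
                 eventually_in x q z).
Proof.
  intros HP Htr HG Hx Hp.
  destruct (maps_members_bounded HV G) as [B HB].
  destruct (function_by_values HV [dom P; ord P; alpha; G; x; p] alpha
    (up P p)
    (fun q z => (exists b : V, b ∈ alpha /\ in_stage G b q z) /\
                eventually_in x q z) (dom P)) as [y [Hfun Hy]].
  - unfold eventually_in. solve_definable.
  - now intros q [Hq _].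
  - intros q Hq.
    destruct (separation HV [dom P; ord P; alpha; G; x; q] alpha
      (fun z => (exists b : V, b ∈ alpha /\ in_stage G b q z) /\
                eventually_in x q z) B) as [Y HY].
    + unfold eventually_in. solve_definable.
    + exists Y. intros z. rewrite (HY z). split; [tauto|]. intros H.
      split; [|assumption]. destruct H as [(b & _ & o & W & _ & HW & Hz) _].
      exact (HB o W z HW Hz).
  - exists y. split; [|assumption].
    apply (proj2 HG); [now right|assumption|].
    apply (proj2 HG) in Hx as (Hfx & _ & Hmono); [|now right|assumption].
    split; [assumption|]. split.
    + intros q Y z _ Hm Hz. now apply (Hy q Y z Hm) in Hz.
    + intros q s Yq Ys z z' Hpq Hqs Hmq Hms Hz Hz'.
      apply (Hy q Yq z Hmq) in Hz 
        as [[b [Hb Hzb]] (r & zr & xr & Hqr & Hzr & Hxr & Hin)].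
      apply (Hy s Ys z' Hms). split.
      * exists b. split; [assumption|].
        apply (stage_transition alpha G b q s z z'); auto.
      * destruct (HP r s (proj1 Hqr) (proj1 Hqs)) as [Hrs|Hsr].
        -- assert (Hup : up P r s) by (split; [exact (proj1 Hqs)|assumption]).
           assert (Hps : up P p s) by now apply up_trans with q.
           destruct (proj2 Hfx s Hps) as [xs [Hxs _]].
           pose proof (up_refl s (proj1 Hqs)) as Hss.
           exists s, z', xs. split; [assumption|]. split.
           { now apply (transition_through s s z). }
           split; [assumption|].
           apply (Hmono r s xr xs zr z'); try assumption.
           { now apply up_trans with q. }
           now apply (transition_through r s z).
        -- assert (Hup : up P s r) by (split; [exact (proj1 Hqr)|assumption]).
           exists r, zr, xr. split; [assumption|]. split; [|now split].
           now apply (transition_through s r z).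
Qed.

End Frame.

Theorem theorem5p1 (V : eps_structure) (P : frame V) (HV : ZFC V)
  (HP : linear P) :
  kripke_satisfies P DCom.
Proof.
  intros p x Hbp (alpha & Hord & G & HG & Hx).
  pose proof (proj1 Hord) as Htr.
  destruct (double_complement_exists HV P alpha G p x HP Htr HG Hx (proj1 Hbp))
    as [y [Hyst Hy]].
  exists y. split.
  { exists alpha. split; [assumption|]. now exists G. }
  intros q z Hpq (alpha' & [Htr' _] & G' & HG' & Hz) r Hqr Hnn.
  cbn in *.
  pose proof (up_trans P _ _ _ Hpq Hqr) as Hpr.
  destruct (transition_exists HV P r z) as [zr Hzr].
  pose proof Hyst as Hyk.
  apply (proj2 HG) in Hyk as (Hyfun & _); [|now right|exact (proj1 Hbp)].
  apply (proj2 HG) in Hx as (_ & Hxval & _); [|now right|exact (proj1 Hbp)].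
  destruct (proj2 Hyfun r Hpr) as [Y [HY _]].
  exists zr, Y. split; [assumption|]. split; [assumption|].
  (* The double negation, read at [r] itself, yields one node [t] at which [z]
     has entered [x]. *)
  assert (Hev : exists t, up P r t /\ exists zt xt,
    transition P t z zt /\ maps x t xt /\ zt ∈ xt).
  { apply NNPP. intros Hno. apply (Hnn r).
    - exact (up_refl P r (proj1 Hqr)).
    - intros t Ht H. apply Hno. now exists t. }
  destruct Hev as (t & Hrt & zt & xt & Hzt & Hxt & Hin).
  assert (Hzrt : transition P t zr zt).
  { now apply (transition_through P r t z). }
  apply (Hy r Y zr HY). split.
  - destruct (Hxval t xt zt (up_trans P _ _ _ Hpr Hrt) Hxt Hin) as [b [Hb Hst]].
    exists b. split; [assumption|].
    (* The stage of [z] is unrelated to [alpha]; only its restriction to [t] is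
       known to lie below [alpha]. *)
    apply (stage_reflection HV P alpha G alpha' G' HP Htr HG Htr' HG' b
             (or_introl Hb) alpha' r t zr zt); auto.
    apply (stage_transition HV P alpha' G' alpha' q r z zr); auto.
  - now exists t, zt, xt.
Qed.
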